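(* Any non-totally geodesic umbilical hypersurface of $\mathbb{H}^k\times\mathbb{S}^{n-k+1}$, $2\leq k\leq n-1$, admits a weakly congruent umbilical deformation.
   Context: $\mathbb{H}^k$ and $\mathbb{S}^m$ have constant sectional curvature $-1$ and $1$; the Riemannian product $\mathbb{H}^k\times\mathbb{S}^{n-k+1}$ is regarded as a submanifold of $\mathbb{L}^{k+1}\oplus\mathbb{R}^{n-k+2}=\mathbb{L}^{n+3}$ (Lorentz space), with $\mathbb{H}^k$ one sheet of $\{\langle x,x\rangle=-1\}\subset\mathbb{L}^{k+1}$ and $\mathbb{S}^{n-k+1}$ the unit sphere. A hypersurface $f\colon M^n\to\mathbb{H}^k\times\mathbb{S}^{n-k+1}$ is umbilical if its shape operator is $A_f=\lambda I$ for a smooth function $\lambda$, and totally geodesic if $A_f=0$. A weakly congruent deformation of $f\colon M^n\to\mathbb{H}^k\times\mathbb{S}^{n-k+1}$ is an isometric immersion $g\colon M^n\to\mathbb{H}^k\times\mathbb{S}^{n-k+1}$ such that, as maps into $\mathbb{L}^{n+3}$, $g=\Phi\circ f$ for some linear isometry $\Phi\colon\mathbb{L}^{n+3}\to\mathbb{L}^{n+3}$ that does not preserve the factors $\mathbb{L}^{k+1}$ and $\mathbb{R}^{n-k+2}$ (and hence does not restrict to an isometry of $\mathbb{H}^k\times\mathbb{S}^{n-k+1}$).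
   Formalization: The manifold M is assumed connected; for disconnected M the claim fails (three pieces in different hyperplane sections admit no such Φ). As in the stated definition, a weakly congruent deformation g is not required to differ from f or to be non-congruent to it. *)

(* Defs.v *)
From HB Require Import structures.
From mathcomp Require Import all_boot all_order all_algebra.
From mathcomp Require Import all_classical all_reals all_analysis.
Set Implicit Arguments.
Unset Strict Implicit.
Unset Printing Implicit Defensive.
Import Order.TTheory GRing.Theory Num.Theory.
Import numFieldNormedType.Exports.
Local Open Scope classical_set_scope.
Local Open Scope ring_scope.

(* C^j on U; only meaningful for U open.  A map is C^(j+1) when it is
   differentiable and all its directional derivatives are C^j. *)
Fixpoint class_C (R : realType) (V W : normedModType R) (j : nat) (U : set V)
    (h : V -> W) : Prop :=
  match j with
  | 0 => forall x, U x -> {for x, continuous h}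
  | i.+1 => (forall x, U x -> differentiable h x) /\
            (forall v, class_C i U (fun x => 'D_v h x))
  end.

Definition smooth (R : realType) (V W : normedModType R) (U : set V)
    (h : V -> W) : Prop :=
  forall j, class_C j U h.

(* [chart_map] and [chart_inv] are total functions; their values off
   [chart_dom] and off its image are irrelevant. *)
Record chart (R : realType) (n : nat) (M : topologicalType) := Chart {
  chart_dom : set M;
  chart_map : M -> 'rV[R]_n;
  chart_inv : 'rV[R]_n -> M;
  chart_dom_open : open chart_dom;
  chart_img_open : open (chart_map @` chart_dom);
  chart_mapK : {in chart_dom, cancel chart_map chart_inv};
  chart_map_cont : forall p, chart_dom p -> {for p, continuous chart_map};
  chart_inv_cont : forall x, (chart_map @` chart_dom) x ->
    {for x, continuous chart_inv}
}.

(* The atlas need not be maximal: all notions below are compatible with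
   smooth changes of charts. *)
Record manifold (R : realType) (n : nat) (M : topologicalType) := Manifold {
  atlas : set (chart R n M);
  manifold_hausdorff : hausdorff_space M;
  manifold_second_countable : @second_countable M;
  manifold_connected : connected [set: M];
  atlas_cover : forall p, exists2 c, atlas c & chart_dom c p;
  atlas_smooth : forall c c', atlas c -> atlas c' ->
    smooth (chart_map c @` (chart_dom c `&` chart_dom c'))
           (chart_map c' \o chart_inv c)
}.

Definition smooth_on (R : realType) (n : nat) (M : topologicalType)
    (X : manifold R n M) (W : normedModType R) (D : set M) (h : M -> W) : Prop :=
  forall c, atlas X c ->
    smooth (chart_map c @` (D `&` chart_dom c)) (h \o chart_inv c).

(* The differential of h at p, applied to the tangent vector whose coordinates
   in the chart c are u. *)
Definition pushforward (R : realType) (n : nat) (M : topologicalType)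
    (W : normedModType R) (c : chart R n M) (h : M -> W) (p : M)
    (u : 'rV[R]_n) : W :=
  'd (h \o chart_inv c) (chart_map c p) u.

Definition bilin (R : realType) (n : nat) (G : 'M[R]_n) (u v : 'rV[R]_n) : R :=
  (u *m G *m v^T) 0 0.

(* [gram c p] is the Gram matrix of the metric at p in the coordinates of c. *)
Record riemannian_metric (R : realType) (n : nat) (M : topologicalType)
    (X : manifold R n M) := RiemannianMetric {
  gram : chart R n M -> M -> 'M[R]_n;
  gram_smooth : forall c, atlas X c ->
    smooth_on X (chart_dom c) (gram c);
  gram_sym : forall c p, atlas X c -> chart_dom c p -> (gram c p)^T = gram c p;
  gram_pos : forall c p u, atlas X c -> chart_dom c p -> u != 0 ->
    0 < bilin (gram c p) u u;
  gram_change : forall c c' p u v, atlas X c -> atlas X c' ->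
    chart_dom c p -> chart_dom c' p ->
    bilin (gram c p) u v =
    bilin (gram c' p) (pushforward c (chart_map c') p u)
                      (pushforward c (chart_map c') p v)
}.

(* L^(k+1) (+) R^(m+1) = L^(k+m+2); the timelike axis is coordinate 0 of the
   first summand. *)
Notation "''L[' R ]_( k , m )" := ('rV[R]_k.+1 * 'rV[R]_m.+1)%type
  (at level 8, k, m at level 50, format "''L[' R ]_( k ,  m )") : type_scope.

Definition lorentz (R : realType) (k : nat) (x y : 'rV[R]_k.+1) : R :=
  - (x 0 ord0 * y 0 ord0)
  + \sum_(i < k) x 0 (lift ord0 i) * y 0 (lift ord0 i).

Definition euclid (R : realType) (m : nat) (x y : 'rV[R]_m.+1) : R :=
  \sum_(i < m.+1) x 0 i * y 0 i.

Definition inner (R : realType) (k m : nat) (x y : 'L[R]_(k, m)) : R :=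
  lorentz x.1 y.1 + euclid x.2 y.2.

Definition hyperbolic (R : realType) (k : nat) : set 'rV[R]_k.+1 :=
  [set x | lorentz x x = -1 /\ 0 < x 0 ord0].

Definition sphere (R : realType) (m : nat) : set 'rV[R]_m.+1 :=
  [set x | euclid x x = 1].

Arguments hyperbolic {R} k.
Arguments sphere {R} m.

Definition hyp_sphere (R : realType) (k m : nat) : set 'L[R]_(k, m) :=
  hyperbolic k `*` sphere m.

Arguments hyp_sphere {R} k m.

(* The tangent space of H^k x S^m at y, and the orthogonal projection of the
   ambient space onto it. *)
Definition tangent (R : realType) (k m : nat) (y : 'L[R]_(k, m)) :
    set 'L[R]_(k, m) :=
  [set z | lorentz z.1 y.1 = 0 /\ euclid z.2 y.2 = 0].

Definition tan_proj (R : realType) (k m : nat) (y z : 'L[R]_(k, m)) :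
    'L[R]_(k, m) :=
  (z.1 + lorentz z.1 y.1 *: y.1, z.2 - euclid z.2 y.2 *: y.2).

(* Immersivity is automatic, the metric being positive definite.  When
   n = k + m - 1 these are the hypersurfaces of H^k x S^m. *)
Definition isometric_immersion (R : realType) (n : nat) (M : topologicalType)
    (X : manifold R n M) (g : riemannian_metric X) (k m : nat)
    (f : M -> 'L[R]_(k, m)) : Prop :=
  [/\ smooth_on X [set: M] f,
      forall p, hyp_sphere k m (f p) &
      forall c p u v, atlas X c -> chart_dom c p ->
        inner (pushforward c f p u) (pushforward c f p v) =
        bilin (gram g c p) u v].

Definition unit_normal (R : realType) (n : nat) (M : topologicalType)
    (X : manifold R n M) (k m : nat) (f : M -> 'L[R]_(k, m)) (D : set M)
    (N : M -> 'L[R]_(k, m)) : Prop :=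
  [/\ smooth_on X D N,
      forall p, D p -> tangent (f p) (N p) /\ inner (N p) (N p) = 1 &
      forall c p u, atlas X c -> D p -> chart_dom c p ->
        inner (pushforward c f p u) (N p) = 0].

(* Weingarten's formula f_*(A u) = - nabla_u N, where nabla, the Levi-Civita
   connection of H^k x S^m, is the tangential part of the flat derivative.
   It determines A, the matrix (acting on row vectors) of the shape operator
   at p in the coordinates of c, since f_* is injective. *)
Definition is_shape_operator (R : realType) (n : nat) (M : topologicalType)
    (k m : nat) (f N : M -> 'L[R]_(k, m)) (c : chart R n M) (p : M)
    (A : 'M[R]_n) : Prop :=
  forall u, pushforward c f p (u *m A) =
            - tan_proj (f p) (pushforward c N p u).

(* M is not assumed orientable, so the unit normal is chosen locally. *)
Definition umbilical (R : realType) (n : nat) (M : topologicalType)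
    (X : manifold R n M) (k m : nat) (f : M -> 'L[R]_(k, m)) : Prop :=
  forall p0, exists D N (lam : M -> R),
    [/\ open_nbhs p0 D, unit_normal X f D N, smooth_on X D lam &
        forall c p, atlas X c -> D p -> chart_dom c p ->
          is_shape_operator f N c p (lam p)%:M].

Definition totally_geodesic (R : realType) (n : nat) (M : topologicalType)
    (X : manifold R n M) (k m : nat) (f : M -> 'L[R]_(k, m)) : Prop :=
  forall p0, exists D N,
    [/\ open_nbhs p0 D, unit_normal X f D N &
        forall c p, atlas X c -> D p -> chart_dom c p ->
          is_shape_operator f N c p 0].

Definition linear_isometry (R : realType) (k m : nat)
    (Phi : {linear 'L[R]_(k, m) -> 'L[R]_(k, m)}) : Prop :=
  forall x y, inner (Phi x) (Phi y) = inner x y.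

Definition preserves_factors (R : realType) (k m : nat)
    (Phi : {linear 'L[R]_(k, m) -> 'L[R]_(k, m)}) : Prop :=
  Phi @` [set x | x.2 = 0] = [set x | x.2 = 0] /\
  Phi @` [set x | x.1 = 0] = [set x | x.1 = 0].

Definition weakly_congruent_deformation (R : realType) (n : nat)
    (M : topologicalType) (X : manifold R n M) (g : riemannian_metric X)
    (k m : nat) (f f' : M -> 'L[R]_(k, m)) : Prop :=
  isometric_immersion g f' /\
  exists Phi : {linear 'L[R]_(k, m) -> 'L[R]_(k, m)},
    [/\ linear_isometry Phi, ~ preserves_factors Phi & f' = Phi \o f].

(* Main.v *)
Require Import Defs.
From HB Require Import structures.
From mathcomp Require Import all_boot all_order all_algebra.
From mathcomp Require Import all_classical all_reals all_analysis.
From mathcomp Require Import ring.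
Import Order.TTheory GRing.Theory Num.Theory.
Import numFieldNormedType.Exports.
Local Open Scope classical_set_scope.
Local Open Scope ring_scope.
Set Implicit Arguments.
Unset Strict Implicit.
Unset Printing Implicit Defensive.

(* In the flat ambient space umbilicity reads dN = - lam df + om f for a 1-form
   om, so d (N + lam f) = theta f with theta = om + d lam.  Since f is null,
   orthogonal to its tangent vectors and an immersion of dimension at least 2,
   the symmetry of the second derivatives of N + lam f forces theta = 0, and
   N + lam f is locally a constant unit vector V orthogonal to f.  By uniqueness
   of the unit normal up to sign and connectedness, one V serves globally, so
   f(M) lies in the hyperplane orthogonal to V and the reflection in V fixes f;
   the deformation is thus f itself.  As lam = <f2, V2> = - <f1, V1>, neither
   component of V vanishes unless f is totally geodesic, and then the reflection
   mixes the two factors. *)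

(* Not the image measure of mathcomp-analysis. *)
Local Notation pushforward := Defs.pushforward.

(** * Calculus *)

(** The first hypothesis on [l] is exactly what moves [l] inside the difference quotient.
    Coordinates and projections of pairs satisfy it as bare functions. *)
Lemma is_derive_linear (R : realType) (V W W' : normedModType R)
    (l : W -> W') (f : V -> W) (x v : V) (df : W) :
  (forall a y z, l (a *: (y - z)) = a *: (l y - l z)) -> continuous l ->
  is_derive x v f df -> is_derive x v (l \o f) (l df).
Proof.
move=> ll lc [fx fE].
have H : (fun h : R => h^-1 *: (((l \o f) \o shift x) (h *: v) - (l \o f) x))
    @ 0^' --> l df.
  rewrite (_ : (fun h : R => _) =
    l \o (fun h : R => h^-1 *: ((f \o shift x) (h *: v) - f x))); last first.
    by apply/funext => h /=; rewrite ll.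
  rewrite -fE; apply: (continuous_cvg _ (lc _) fx).
by apply: DeriveDef; [apply/cvg_ex; exists (l df) | apply: cvg_lim].
Qed.

Lemma is_derive_line (R : realType) (V W : normedModType R) (f : V -> W)
    (x v : V) (a : R) (df : W) :
  is_derive (a *: v + x) v f df ->
  is_derive a 1 (fun s : R => f (s *: v + x)) df.
Proof.
move=> [fx fE].
have E : (fun h : R => h^-1 *: (((fun s : R => f (s *: v + x)) \o shift a)
      (h *: (1 : R)) - f (a *: v + x))) =
    (fun h : R => h^-1 *: ((f \o shift (a *: v + x)) (h *: v) - f (a *: v + x))).
  by apply/funext => h /=; rewrite [h *: 1]mulr1 scalerDl addrA.
by apply: DeriveDef; [rewrite /derivable E | rewrite /derive E].
Qed.

Lemma mean_value (R : realType) (f df : R -> R) (b : R) : 0 < b ->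
  (forall s, 0 <= s <= b -> is_derive s 1 f (df s)) ->
  exists2 c, 0 <= c <= b & f b - f 0 = df c * b.
Proof.
move=> b0 fD.
have [||c] := @MVT R f df 0 b b0.
- by move=> s; rewrite in_itv /= => /andP[s0 sb]; apply: fD; rewrite !ltW.
- apply: derivable_within_continuous => s; rewrite in_itv /= => sb.
  by have := fD s sb => -[].
by rewrite in_itv /= subr0 => /andP[c0 cb] cE; exists c; rewrite ?ltW.
Qed.

(** Balls are convex, so the mean value theorem applies along the segment from [x] to [y]. *)
Lemma constant_on_ball (R : realType) (V : normedModType R) (h : V -> R)
    (x : V) (r : R) :
  (forall y v, ball x r y -> is_derive y v h 0) ->
  forall y, ball x r y -> h y = h x.
Proof.
move=> hD y yr.
have [|s /andP[s0 s1]|c _] :=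
    @mean_value R (fun s => h (s *: (y - x) + x)) (fun=> 0) 1.
- by [].
- apply/is_derive_line/hD; move: yr; rewrite -!ball_normE /= => yr.
  rewrite distrC addrK normrZ ger0_norm // distrC.
  by apply: le_lt_trans yr; rewrite ler_piMl.
by rewrite scale1r subrK scale0r add0r mul0r => /eqP; rewrite subr_eq0 => /eqP.
Qed.

(** The mean value theorem in direction [u] turns the second difference into [t] times an increment
    of [g], and the first-order expansion of [g] at [x] evaluates that increment. Differentiability
    of [g] at the single point [x] suffices. *)
Lemma second_difference (R : realType) (V : normedModType R) (h g : V -> R)
    (x u v : V) (e : R) : 0 < e ->
  (\forall y \near x, is_derive y u h (g y)) -> differentiable g x ->
  exists2 d, 0 < d & forall t, 0 < t < d ->
    `|h (t *: u + (t *: v + x)) - h (t *: v + x) - h (t *: u + x) + h x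
      - t ^+ 2 * 'D_v g x| <= t ^+ 2 * e.
Proof.
move=> e0 hu gx.
(* The points [c *: u] and [c *: u + t *: v] with [0 <= c <= t] have norm at most [t * K]; the
   summand 1 keeps [K] positive. Two expansion errors of relative size [e / (2 * K)] then add up to
   at most [t * e]. *)
pose K := `|u| + `|v| + 1.
have K0 : 0 < K by rewrite ltr_wpDl // addr_ge0.
have e'0 : 0 < e / (2 * K) by rewrite divr_gt0 // mulr_gt0.
have [r r0 Hr] : exists2 r, 0 < r & forall w, `|w| < r ->
    is_derive (w + x) u h (g (w + x)) /\
    `|g (w + x) - g x - 'd g x w| <= e / (2 * K) * `|w|.
  have /diff_locallyP[_] := gx; set k := 'o _ => gE.
  have := hu; rewrite (near_shift 0) => /nbhs_ballP[r1 /= r10 H1].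
  have /nbhs_ballP[r2 /= r20 H2] : \forall w \near (0 : V),
      `|g (w + x) - g x - 'd g x w| <= e / (2 * K) * `|w|.
    near=> w.
    have -> : g (w + x) - g x - 'd g x w = k w.
      have := congr1 (fun F => F w) gE => /= ->.
      by rewrite -[LHS]/(g x + 'd g x w + k w - g x - 'd g x w); ring.
    near: w; exact: (littleoP [littleo of k]).
  exists (Num.min r1 r2); first by rewrite lt_min r10.
  move=> w; rewrite lt_min => /andP[w1 w2]; split.
    by have := H1 w; rewrite /= subr0; apply; rewrite -ball_normE /= sub0r normrN.
  by apply: H2; rewrite -ball_normE /= sub0r normrN.
exists (r / K); first by rewrite divr_gt0.
move=> t /andP[t0 tr].
have bnd c : 0 <= c <= t ->
    `|c *: u| <= t * K /\ `|c *: u + t *: v| <= t * K.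
  move=> /andP[c0 ct]; have cu : `|c *: u| <= t * `|u|.
    by rewrite normrZ ger0_norm // ler_wpM2r.
  split; first by apply: le_trans cu _; rewrite ler_pM2l // /K -addrA lerDl addr_ge0.
  apply: le_trans (ler_normD _ _) _; rewrite [X in _ + X]normrZ (gtr0_norm t0).
  apply: le_trans (lerD cu (lexx _)) _.
  by rewrite -mulrDr ler_pM2l // /K lerDl.
have tKr : t * K < r by rewrite -ltr_pdivlMr.
pose phi s := h (s *: u + (t *: v + x)) - h (s *: u + x).
have [||c cb] := @mean_value R phi
    (fun s => g (s *: u + (t *: v + x)) - g (s *: u + x)) t.
- by [].
- move=> s /bnd[s1 s2]; apply: is_deriveB.
    apply: is_derive_line; rewrite addrA.
    by have [] := Hr (s *: u + t *: v) (le_lt_trans s2 tKr).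
  apply: is_derive_line.
  by have [] := Hr (s *: u) (le_lt_trans s1 tKr).
rewrite /phi !scale0r !add0r.
have [c1 c2] := bnd c cb.
have [_ G1] := Hr _ (le_lt_trans c1 tKr).
have [_ G2] := Hr _ (le_lt_trans c2 tKr).
rewrite deriveE // => phiE.
have -> : h (t *: u + (t *: v + x)) - h (t *: v + x) - h (t *: u + x) + h x =
  h (t *: u + (t *: v + x)) - h (t *: u + x) - (h (t *: v + x) - h x) by ring.
rewrite phiE addrA.
rewrite (linearZ_LR ('d g x)) in G1.
rewrite (linearD ('d g x)) !(linearZ_LR ('d g x)) in G2.
set A := g (c *: u + x) in G1 *; set B := g _ in G2 *.
set du := 'd g x u in G1 G2; set dv := 'd g x v in G2 *.
(* The linear terms [c *: du] at the two points cancel, so the unknown [c] leaves the main term and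
   survives only in the remainders. *)
have -> : (B - A) * t - t ^+ 2 * dv =
  t * ((B - g x - (c *: du + t *: dv)) - (A - g x - c *: du)).
  by rewrite /GRing.scale /=; ring.
rewrite normrM (gtr0_norm t0) expr2 -mulrA ler_pM2l //.
apply: le_trans (ler_normB _ _) _.
apply: le_trans (lerD (le_trans G2 (ler_wpM2l (ltW e'0) c2))
  (le_trans G1 (ler_wpM2l (ltW e'0) c1))) _.
rewrite le_eqVlt; apply/orP; left; apply/eqP; field.
by rewrite gt_eqF.
Unshelve. all: by end_near. Qed.

(* Both mixed derivatives are the limit of the same second difference quotient. *)
Lemma derive_sym (R : realType) (V : normedModType R) (h hu hv : V -> R)
    (x u v : V) :
  (\forall y \near x, is_derive y u h (hu y)) ->
  (\forall y \near x, is_derive y v h (hv y)) ->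
  differentiable hu x -> differentiable hv x ->
  'D_v hu x = 'D_u hv x.
Proof.
move=> hu' hv' gu gv; apply/eqP; rewrite -subr_eq0 -normr_le0.
apply/ler_addgt0Pl => e e0; rewrite addr0.
have e2 : 0 < e / 2 by rewrite divr_gt0.
have [d1 d10 H1] := second_difference v e2 hu' gu.
have [d2 d20 H2] := second_difference u e2 hv' gv.
pose t := Num.min d1 d2 / 2.
have m0 : 0 < Num.min d1 d2 by rewrite lt_min d10.
have t0 : 0 < t by rewrite divr_gt0.
have : t < Num.min d1 d2 by rewrite /t ltr_pdivrMr // ltr_pMr // ltr1n.
rewrite lt_min => /andP[t1 t2].
have {}H1 := H1 t; have {}H2 := H2 t.
move: H1 H2; rewrite t0 t1 t2 => /(_ isT) H1 /(_ isT) H2.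
have tt0 : 0 < t ^+ 2 by rewrite exprn_gt0.
rewrite -(ler_pM2l tt0) -[X in X * `|_|](gtr0_norm tt0) -normrM.
(* Swapping the two increments makes the second differences in [H1] and [H2] equal, so they cancel
   in [S2 - S1]. *)
move: H1 H2; rewrite [t *: u + (t *: v + x)]addrCA.
set S1 := _ + _ - _; set S2 := _ + _ - _ => H1 H2.
have -> : t ^+ 2 * ('D_v hu x - 'D_u hv x) = S2 - S1.
  by rewrite /S1 /S2; ring.
by apply: le_trans (ler_normB _ _) _; rewrite [e]splitr mulrDr lerD.
Qed.

(** * The scalar products *)

Lemma lorentzC (R : realType) k (x y : 'rV[R]_k.+1) : lorentz x y = lorentz y x.
Proof.
rewrite /lorentz mulrC; congr (_ + _).
by apply: eq_bigr => i _; rewrite mulrC.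
Qed.

Lemma euclidC (R : realType) m (x y : 'rV[R]_m.+1) : euclid x y = euclid y x.
Proof. by apply: eq_bigr => i _; rewrite mulrC. Qed.

Lemma innerC (R : realType) k m (x y : 'L[R]_(k, m)) : inner x y = inner y x.
Proof. by rewrite /inner lorentzC euclidC. Qed.

Lemma lorentzP (R : realType) k (a : R) (x y z : 'rV[R]_k.+1) :
  lorentz (a *: x + y) z = a * lorentz x z + lorentz y z.
Proof.
rewrite /lorentz !mxE; under eq_bigr do rewrite !mxE mulrDl -mulrA.
rewrite big_split /= -mulr_sumr; ring.
Qed.

Lemma euclidP (R : realType) m (a : R) (x y z : 'rV[R]_m.+1) :
  euclid (a *: x + y) z = a * euclid x z + euclid y z.
Proof.
rewrite /euclid; under eq_bigr do rewrite !mxE mulrDl -mulrA.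
by rewrite big_split /= -mulr_sumr.
Qed.

Lemma innerP (R : realType) k m (a : R) (x y z : 'L[R]_(k, m)) :
  inner (a *: x + y) z = a * inner x z + inner y z.
Proof. by rewrite /inner lorentzP euclidP; ring. Qed.

Lemma lorentz0l (R : realType) k (z : 'rV[R]_k.+1) : lorentz 0 z = 0.
Proof. by have := lorentzP (-1) z z z; rewrite scaleN1r addNr mulN1r addNr. Qed.

Lemma lorentzDl (R : realType) k (x y z : 'rV[R]_k.+1) :
  lorentz (x + y) z = lorentz x z + lorentz y z.
Proof. by rewrite -[x in LHS]scale1r lorentzP mul1r. Qed.

Lemma lorentzZl (R : realType) k (a : R) (x z : 'rV[R]_k.+1) :
  lorentz (a *: x) z = a * lorentz x z.
Proof. by rewrite -[a *: x]addr0 lorentzP lorentz0l addr0. Qed.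

Lemma lorentzNl (R : realType) k (x z : 'rV[R]_k.+1) :
  lorentz (- x) z = - lorentz x z.
Proof. by rewrite -scaleN1r lorentzZl mulN1r. Qed.

Lemma lorentzDr (R : realType) k (x y z : 'rV[R]_k.+1) :
  lorentz z (x + y) = lorentz z x + lorentz z y.
Proof. by rewrite ![lorentz z _]lorentzC lorentzDl. Qed.

Lemma lorentzZr (R : realType) k (a : R) (x z : 'rV[R]_k.+1) :
  lorentz z (a *: x) = a * lorentz z x.
Proof. by rewrite ![lorentz z _]lorentzC lorentzZl. Qed.

Lemma euclid0l (R : realType) m (z : 'rV[R]_m.+1) : euclid 0 z = 0.
Proof. by have := euclidP (-1) z z z; rewrite scaleN1r addNr mulN1r addNr. Qed.

Lemma euclidDl (R : realType) m (x y z : 'rV[R]_m.+1) :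
  euclid (x + y) z = euclid x z + euclid y z.
Proof. by rewrite -[x in LHS]scale1r euclidP mul1r. Qed.

Lemma euclidZl (R : realType) m (a : R) (x z : 'rV[R]_m.+1) :
  euclid (a *: x) z = a * euclid x z.
Proof. by rewrite -[a *: x]addr0 euclidP euclid0l addr0. Qed.

Lemma euclidNl (R : realType) m (x z : 'rV[R]_m.+1) :
  euclid (- x) z = - euclid x z.
Proof. by rewrite -scaleN1r euclidZl mulN1r. Qed.

Lemma inner0l (R : realType) k m (z : 'L[R]_(k, m)) : inner 0 z = 0.
Proof. by have := innerP (-1) z z z; rewrite scaleN1r addNr mulN1r addNr. Qed.

Lemma innerDl (R : realType) k m (x y z : 'L[R]_(k, m)) :
  inner (x + y) z = inner x z + inner y z.
Proof. by rewrite -[x in LHS]scale1r innerP mul1r. Qed.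

Lemma innerZl (R : realType) k m (a : R) (x z : 'L[R]_(k, m)) :
  inner (a *: x) z = a * inner x z.
Proof. by rewrite -[a *: x]addr0 innerP inner0l addr0. Qed.

Lemma innerNl (R : realType) k m (x z : 'L[R]_(k, m)) :
  inner (- x) z = - inner x z.
Proof. by rewrite -scaleN1r innerZl mulN1r. Qed.

Lemma innerDr (R : realType) k m (x y z : 'L[R]_(k, m)) :
  inner z (x + y) = inner z x + inner z y.
Proof. by rewrite ![inner z _]innerC innerDl. Qed.

Lemma innerZr (R : realType) k m (a : R) (x z : 'L[R]_(k, m)) :
  inner z (a *: x) = a * inner z x.
Proof. by rewrite ![inner z _]innerC innerZl. Qed.

Lemma innerNr (R : realType) k m (x z : 'L[R]_(k, m)) :
  inner z (- x) = - inner z x.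
Proof. by rewrite ![inner z _]innerC innerNl. Qed.

(** Pairing with the standard basis reads off every coordinate, up to sign on the timelike axis.
    Identities between ambient vectors thereby reduce to identities between real functions. *)
Lemma inner_nondegenerate (R : realType) k m (x : 'L[R]_(k, m)) :
  (forall e, inner x e = 0) -> x = 0.
Proof.
move=> x0; case: x x0 => x1 x2 x0; congr pair; apply/rowP => i; rewrite mxE.
  have := x0 (delta_mx 0 i, 0); rewrite /inner /= euclidC euclid0l addr0.
  rewrite /lorentz; case: (unliftP ord0 i) => [j|] ->.
    rewrite !mxE eqxx /= mulr0 oppr0 add0r (bigD1 j) //= !mxE !eqxx mulr1.
    rewrite big1 ?addr0 // => l lj.
    by rewrite !mxE (inj_eq lift_inj) (negbTE lj) mulr0.
  rewrite !mxE !eqxx mulr1 big1 ?addr0 => [/eqP|l _].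
    by rewrite oppr_eq0 => /eqP.
  by rewrite !mxE mulr0.
have := x0 (0, delta_mx 0 i); rewrite /inner /= lorentzC lorentz0l add0r.
rewrite /euclid (bigD1 i) //= !mxE !eqxx mulr1 big1 ?addr0 // => l li.
by rewrite !mxE (negbTE li) mulr0.
Qed.

(** * Derivatives of the scalar products *)

Lemma is_derive_coord (R : realType) (V : normedModType R) n
    (A : V -> 'rV[R]_n) (x v : V) dA i :
  is_derive x v A dA -> is_derive x v (fun y => A y 0 i) (dA 0 i).
Proof.
apply: (@is_derive_linear _ _ _ _ (fun B : 'rV[R]_n => B 0 i)).
  by move=> a y z; rewrite !mxE.
exact: coord_continuous.
Qed.

Lemma is_derive_euclid (R : realType) (V : normedModType R) m
    (A B : V -> 'rV[R]_m.+1) (x v : V) dA dB :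
  is_derive x v A dA -> is_derive x v B dB ->
  is_derive x v (fun y => euclid (A y) (B y))
    (euclid dA (B x) + euclid (A x) dB).
Proof.
move=> hA hB.
have -> : (fun y => euclid (A y) (B y)) =
    \sum_(i < m.+1) ((fun y => A y 0 i) * (fun y => B y 0 i)).
  by apply/funext => y; rewrite fct_sumE.
have -> : euclid dA (B x) + euclid (A x) dB =
    \sum_(i < m.+1) (A x 0 i *: dB 0 i + B x 0 i *: dA 0 i).
  rewrite /euclid -big_split; apply: eq_bigr => i _ /=.
  by rewrite /GRing.scale /=; ring.
by apply: is_derive_sum => i; apply: is_deriveM; apply: is_derive_coord.
Qed.

Lemma is_derive_lorentz (R : realType) (V : normedModType R) k
    (A B : V -> 'rV[R]_k.+1) (x v : V) dA dB :
  is_derive x v A dA -> is_derive x v B dB ->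
  is_derive x v (fun y => lorentz (A y) (B y))
    (lorentz dA (B x) + lorentz (A x) dB).
Proof.
move=> hA hB.
have -> : (fun y => lorentz (A y) (B y)) =
    - ((fun y => A y 0 ord0) * (fun y => B y 0 ord0)) +
    \sum_(i < k) ((fun y => A y 0 (lift ord0 i)) * (fun y => B y 0 (lift ord0 i))).
  apply/funext => y; rewrite /lorentz /=.
  by rewrite -[RHS]/(- (A y 0 ord0 * B y 0 ord0) + _) fct_sumE.
have -> : lorentz dA (B x) + lorentz (A x) dB =
    - (A x 0 ord0 *: dB 0 ord0 + B x 0 ord0 *: dA 0 ord0) +
    \sum_(i < k) (A x 0 (lift ord0 i) *: dB 0 (lift ord0 i)
                 + B x 0 (lift ord0 i) *: dA 0 (lift ord0 i)).
  rewrite /lorentz addrACA -big_split; congr (_ + _).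
    by rewrite /GRing.scale /=; ring.
  apply: eq_bigr => i _ /=; rewrite /GRing.scale /=; ring.
apply: is_deriveD; first by apply: is_deriveN; apply: is_deriveM; apply: is_derive_coord.
by apply: is_derive_sum => i; apply: is_deriveM; apply: is_derive_coord.
Qed.

Lemma is_derive_fst (R : realType) (V W W' : normedModType R)
    (A : V -> W * W') (x v : V) dA :
  is_derive x v A dA -> is_derive x v (fun y => (A y).1) dA.1.
Proof.
by apply: (@is_derive_linear _ _ _ _ fst) => // z; apply: cvg_fst.
Qed.

Lemma is_derive_snd (R : realType) (V W W' : normedModType R)
    (A : V -> W * W') (x v : V) dA :
  is_derive x v A dA -> is_derive x v (fun y => (A y).2) dA.2.
Proof.
by apply: (@is_derive_linear _ _ _ _ snd) => // z; apply: cvg_snd.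
Qed.

Lemma is_derive_inner (R : realType) (V : normedModType R) k m
    (A B : V -> 'L[R]_(k, m)) (x v : V) dA dB :
  is_derive x v A dA -> is_derive x v B dB ->
  is_derive x v (fun y => inner (A y) (B y)) (inner dA (B x) + inner (A x) dB).
Proof.
move=> hA hB; rewrite /inner addrACA; apply: is_deriveD.
  by apply: is_derive_lorentz; apply: is_derive_fst.
by apply: is_derive_euclid; apply: is_derive_snd.
Qed.

(** Symmetry of second derivatives asks for full differentiability of the first derivatives, which
    directional product rules do not give. Here it follows because the pairing with [e] is a linear
    combination of coordinates. *)
Lemma differentiable_innerl (R : realType) (V : normedModType R) k m
    (A : V -> 'L[R]_(k, m)) (x : V) e :
  differentiable A x -> differentiable (fun y => inner (A y) e) x.
Proof.
move=> Ax; apply: (@differentiable_comp _ _ _ _ A (fun z => inner z e)) => //.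
set z := A x; have d1 i : differentiable (fun z : 'L[R]_(k, m) => z.1 0 i) z.
  apply: (@differentiable_comp _ _ _ _ fst (fun z : 'rV[R]_k.+1 => z 0 i)).
    by apply: linear_differentiable => ?; exact: cvg_fst.
  exact: differentiable_coord.
have d2 i : differentiable (fun z : 'L[R]_(k, m) => z.2 0 i) z.
  apply: (@differentiable_comp _ _ _ _ snd (fun z : 'rV[R]_m.+1 => z 0 i)).
    by apply: linear_differentiable => ?; exact: cvg_snd.
  exact: differentiable_coord.
have -> : (fun z => inner z e) =
    - ((fun z : 'L[R]_(k, m) => z.1 0 ord0) * cst (e.1 0 ord0))
    + \sum_(i < k) ((fun z : 'L[R]_(k, m) => z.1 0 (lift ord0 i))
                      * cst (e.1 0 (lift ord0 i)))
    + \sum_(i < m.+1) ((fun z : 'L[R]_(k, m) => z.2 0 i) * cst (e.2 0 i)).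
  apply/funext => y; rewrite /inner /lorentz /euclid.
  by rewrite -[RHS]/(- (y.1 0 ord0 * e.1 0 ord0) + _ y + _ y) !fct_sumE.
apply: differentiableD; first apply: differentiableD.
- by apply: differentiableN; apply: differentiableM.
- by apply: differentiable_sum => i; apply: differentiableM.
- by apply: differentiable_sum => i; apply: differentiableM.
Qed.

(** * Umbilical immersions in coordinates *)

(** This differentiates an identity such as [lorentz x x = -1] along a map: [dh] is the expression
    given by the product rule. *)
Lemma is_derive_locally_constant (R : realType) (V : normedModType R)
    (h : V -> R) (c : R) (x v : V) (dh : R) :
  (\forall y \near x, h y = c) -> is_derive x v h dh -> dh = 0.
Proof.
move=> hc hD.
have := @near_eq_is_derive _ _ _ _ (cst c) _ _ _ hc hD.
by move=> [_ <-]; rewrite derive_cst.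
Qed.

Lemma tangent_derive (R : realType) (V : normedModType R) k m
    (F : V -> 'L[R]_(k, m)) (x v : V) : differentiable F x ->
  (\forall y \near x, hyp_sphere k m (F y)) -> tangent (F x) ('D_v F x).
Proof.
move=> /(diff_derivable (v := v))/derivableP FD Fprod; split.
  have := is_derive_lorentz (is_derive_fst FD) (is_derive_fst FD).
  move/(is_derive_locally_constant (c := -1)); rewrite [X in _ + X]lorentzC.
  rewrite -mulr2n => /(_ _)/eqP; rewrite mulrn_eq0 /= => E; apply/eqP/E.
  by apply: filterS Fprod => y [[]].
have := is_derive_euclid (is_derive_snd FD) (is_derive_snd FD).
move/(is_derive_locally_constant (c := 1)); rewrite [X in _ + X]euclidC.
rewrite -mulr2n => /(_ _)/eqP; rewrite mulrn_eq0 /= => E; apply/eqP/E.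
by apply: filterS Fprod => y [].
Qed.

(** The regularity that [derive_sym] consumes: first derivatives are differentiable at each point,
    with no continuity of second derivatives. *)
Definition twice_differentiable (R : realType) (V W : normedModType R)
    (U : set V) (h : V -> W) :=
  forall y, U y -> differentiable h y /\ forall v, differentiable ('D_v h) y.

Lemma smooth_twice_differentiable (R : realType) (V W : normedModType R)
    (U : set V) (h : V -> W) : smooth U h -> twice_differentiable U h.
Proof.
move=> /(_ 2)[h1 h2] y Uy; split; first exact: h1.
by move=> v; have [+ _] := h2 v; apply.
Qed.

(** The immersion, its normal and its principal curvature read in a chart, so that the calculus
    takes place on an open subset of a normed space. *)
Record umbilic_immersion (R : realType) (V : normedModType R) (k m : nat)
    (U : set V) (F N : V -> 'L[R]_(k, m)) (lam : V -> R) : Prop := {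
  umbilic_smooth : twice_differentiable U F;
  umbilic_normal_smooth : twice_differentiable U N;
  umbilic_curvature_smooth : twice_differentiable U lam;
  umbilic_product : forall y, U y -> hyp_sphere k m (F y);
  umbilic_tangent : forall y, U y -> tangent (F y) (N y);
  umbilic_orthogonal : forall y v, U y -> inner ('D_v F y) (N y) = 0;
  umbilic_immersed : forall y v, U y -> v != 0 ->
    0 < inner ('D_v F y) ('D_v F y);
  umbilic_shape : forall y v, U y ->
    lam y *: 'D_v F y = - tan_proj (F y) ('D_v N y)
}.

(** Expand the first argument only: [inner z z = s * inner x z - t * inner y z]. *)
Lemma inner_self0 (R : realType) k m (s t : R) (x y z : 'L[R]_(k, m)) :
  z = s *: x - t *: y -> s * inner x z = t * inner y z -> inner z z = 0.
Proof.
by move=> zE st; rewrite {1}zE innerDl innerNl !innerZl st subrr.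
Qed.

Section UmbilicImmersion.
Context (R : realType) (V : normedModType R) (k m : nat) (U : set V)
  (F N : V -> 'L[R]_(k, m)) (lam : V -> R).
Context (Uo : open U) (H : umbilic_immersion U F N lam).

Let nearU y : U y -> \forall z \near y, U z.
Proof. by move=> Uy; apply: open_nbhs_nbhs. Qed.

Let FD y v : U y -> is_derive y v F ('D_v F y).
Proof. by move=> /(umbilic_smooth H)[+ _] => /diff_derivable/derivableP. Qed.

Let ND y v : U y -> is_derive y v N ('D_v N y).
Proof. by move=> /(umbilic_normal_smooth H)[+ _] => /diff_derivable/derivableP. Qed.

Let lamD y v : U y -> is_derive y v lam ('D_v lam y).
Proof. by move=> /(umbilic_curvature_smooth H)[+ _] => /diff_derivable/derivableP. Qed.

Let FT y v : U y -> tangent (F y) ('D_v F y).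
Proof.
move=> Uy; apply: tangent_derive; first by have [] := umbilic_smooth H Uy.
by apply: filterS (nearU Uy) => z; apply: (umbilic_product H).
Qed.

Lemma inner_position_derive y v : U y -> inner (F y) ('D_v F y) = 0.
Proof.
by move=> /(FT v)[E1 E2]; rewrite innerC /inner E1 E2 addr0.
Qed.

(* The tangential Weingarten formula loses nothing of the ambient derivative of
   N but a multiple of F: both normal components carry the same coefficient
   because the first and second components of N are opposite on tangent
   vectors. *)
Lemma derive_normal y v : U y ->
  'D_v N y = - (lam y *: 'D_v F y) + lorentz (N y).1 ('D_v F y).1 *: F y.
Proof.
move=> Uy; rewrite (umbilic_shape H) // opprK.
have E1 : lorentz ('D_v N y).1 (F y).1 = - lorentz (N y).1 ('D_v F y).1.
  apply/eqP; rewrite -addr_eq0; apply/eqP.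
  apply: (is_derive_locally_constant (c := 0)) (is_derive_lorentz
    (is_derive_fst (ND v Uy)) (is_derive_fst (FD v Uy))).
  by apply: filterS (nearU Uy) => z /(umbilic_tangent H)[].
have E2 : euclid ('D_v N y).2 (F y).2 = - euclid (N y).2 ('D_v F y).2.
  apply/eqP; rewrite -addr_eq0; apply/eqP.
  apply: (is_derive_locally_constant (c := 0)) (is_derive_euclid
    (is_derive_snd (ND v Uy)) (is_derive_snd (FD v Uy))).
  by apply: filterS (nearU Uy) => z /(umbilic_tangent H)[].
have E3 : euclid (N y).2 ('D_v F y).2 = - lorentz (N y).1 ('D_v F y).1.
  apply/eqP; rewrite -addr_eq0 addrC euclidC lorentzC.
  by rewrite -[_ + _]/(inner _ _) (umbilic_orthogonal H).
rewrite /tan_proj E1 E2 E3 opprK.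
by apply: injective_projections; rewrite /= ?scaleNr subrK.
Qed.

(** The first summand is the coefficient of [F] in ['D_v N]; the second comes from differentiating
    [lam] in [lam F]. *)
Let theta v y := lorentz (N y).1 ('D_v F y).1 + 'D_v lam y.

Let axisD e y v : U y ->
  is_derive y v (fun z => inner (N z) e + lam z * inner (F z) e)
    (inner ('D_v N y) e + (lam y * inner ('D_v F y) e
       + 'D_v lam y * inner (F y) e)).
Proof.
move=> Uy.
have FeD : is_derive y v (fun z => inner (F z) e) (inner ('D_v F y) e).
  have := is_derive_inner (FD v Uy) (is_derive_cst e y v).
  by rewrite [X in _ + X]innerC inner0l addr0.
have NeD : is_derive y v (fun z => inner (N z) e) (inner ('D_v N y) e).
  have := is_derive_inner (ND v Uy) (is_derive_cst e y v).
  by rewrite [X in _ + X]innerC inner0l addr0.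
apply: is_deriveD; rewrite [X in _ + X]mulrC.
exact: is_deriveM (lamD v Uy) FeD.
Qed.

(** Umbilicity enters here: the tangential part of the derivative of [N] is cancelled by [lam] times
    the derivative of [F]. *)
Let axis_derivE e y v : U y ->
  inner ('D_v N y) e + (lam y * inner ('D_v F y) e + 'D_v lam y * inner (F y) e)
  = theta v y * inner (F y) e.
Proof.
move=> Uy; rewrite derive_normal // innerDl innerNl !innerZl /theta; ring.
Qed.

(* The 1-form [theta v] satisfies [d (N + lam F) = theta F]; pairing the
   symmetric second derivative of N + lam F with a tangent vector e kills the
   derivative of [theta], because F is orthogonal to e at y. *)
Let theta_sym y u v e : U y -> inner (F y) e = 0 ->
  theta u y * inner ('D_v F y) e = theta v y * inner ('D_u F y) e.
Proof.
move=> Uy Fe.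
(* This is the derivative of the paired axis in product-rule form, which is visibly differentiable.
   On [U] it equals [theta w] times [inner (F z) e], and that second form gives its derivative at
   [y]. *)
pose g w z := inner ('D_w N z) e + (lam z * inner ('D_w F z) e
       + 'D_w lam z * inner (F z) e).
have gdiff w : differentiable (g w) y.
  have [F1 F2] := umbilic_smooth H Uy; have [_ N2] := umbilic_normal_smooth H Uy.
  have [l1 l2] := umbilic_curvature_smooth H Uy.
  apply: differentiableD; first exact: differentiable_innerl.
  apply: differentiableD; apply: differentiableM => //; exact: differentiable_innerl.
have gD w w' : 'D_w' (g w) y = theta w y * inner ('D_w' F y) e.
  have [F1 F2] := umbilic_smooth H Uy.
  have [l1 l2] := umbilic_curvature_smooth H Uy.
  have FeD : is_derive y w' (fun z => inner (F z) e) (inner ('D_w' F y) e).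
    have := is_derive_inner (FD w' Uy) (is_derive_cst e y w').
    by rewrite [X in _ + X]innerC inner0l addr0.
  have thetaD : derivable (theta w) y w'.
    apply: derivableD; last exact: diff_derivable.
    have D2 := derivableP (diff_derivable (v := w') (F2 w)).
    by have [] := is_derive_lorentz (is_derive_fst (ND w' Uy)) (is_derive_fst D2).
  have [_ +] := is_deriveM (derivableP thetaD) FeD.
  rewrite Fe scale0r addr0 => E.
  transitivity ('D_w' (theta w * (fun z => inner (F z) e)) y); last exact: E.
  apply: near_eq_derive.
  by apply: filterS (nearU Uy) => z Uz; exact: axis_derivE.
have hD w : \forall z \near y,
    is_derive z w (fun z => inner (N z) e + lam z * inner (F z) e) (g w z).
  by apply: filterS (nearU Uy) => z Uz; apply: axisD.
by rewrite -!gD; apply: derive_sym (hD u) (hD v) (gdiff u) (gdiff v).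
Qed.

(** The hypothesis [Vdim] forces dimension at least 2. If [theta v] were nonzero, take [w] not
    proportional to [v]: the vector [theta v *: w - theta w *: v] is nonzero, yet [theta_sym], with
    [e] its image under the differential of [F], makes that image orthogonal to itself, against
    immersivity. *)
Lemma is_derive_umbilic_axis (Vdim : forall u : V, exists v, forall a, v != a *: u)
    y v e : U y ->
  is_derive y v (fun z => inner (N z) e + lam z * inner (F z) e) 0.
Proof.
move=> Uy; suff t0 : theta v y = 0.
  by have := axisD e v Uy; rewrite axis_derivE // t0 mul0r.
apply/eqP/negPn/negP => t0.
have [w] := Vdim v; move=> /(_ (theta w y / theta v y))/eqP; apply.
have DL z : 'D_z F y = 'd F y z by rewrite deriveE //; have [] := umbilic_smooth H Uy.
have DZ : 'D_(theta v y *: w - theta w y *: v) F y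
    = theta v y *: 'D_w F y - theta w y *: 'D_v F y.
  by rewrite !DL linearB !linearZ.
have : theta v y *: w - theta w y *: v = 0.
  apply/eqP/negPn/negP => /(umbilic_immersed H Uy).
  have := inner_position_derive (theta v y *: w - theta w y *: v) Uy.
  move: DZ; move: ('D_(_ - _) F y) => e' e'E Fe'.
  by rewrite (inner_self0 e'E (theta_sym v w Uy Fe')) ltxx.
move/eqP; rewrite subr_eq0 => /eqP/(congr1 ( *:%R (theta v y)^-1)).
by rewrite !scalerA mulVf // scale1r mulrC.
Qed.

End UmbilicImmersion.

(* The normals y.1 and y.2, the image of d and N fill the ambient space by a
   dimension count, and N' is orthogonal to all of them but N. *)
Lemma unit_normal_unique (R : realType) (n k m : nat) (hn : (k + m = n.+1)%N)
    (d : {linear 'rV[R]_n -> 'L[R]_(k, m)}) (y N N' : 'L[R]_(k, m)) :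
  hyp_sphere k m y -> (forall u, tangent y (d u)) ->
  (forall u, u != 0 -> 0 < inner (d u) (d u)) ->
  tangent y N -> inner N N = 1 -> (forall u, inner (d u) N = 0) ->
  tangent y N' -> (forall u, inner (d u) N' = 0) ->
  N' = inner N' N *: N.
Proof.
move=> [[y1 _] y2] dy d0 [N1 N2] NN dN [N1' N2'] dN'; rewrite /= in y1 y2.
pose T (z : 'rV[R]_n * (R^o * R^o * R^o)) : 'L[R]_(k, m) :=
  d z.1 + (z.2.1.1 *: y.1, z.2.1.2 *: y.2) + z.2.2 *: N.
have Tlin : linear T.
  move=> a [u [[b c] e]] [u' [[b' c'] e']]; rewrite /T /= linearP.
  by apply: injective_projections; apply/rowP => i;
     rewrite /= /GRing.scale /= !mxE; ring.
pose TL : {linear _ -> _} := HB.pack T (GRing.isLinear.Build _ _ _ _ T Tlin).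
have E1 z : lorentz (T z).1 y.1 = - z.2.1.1.
  have [t1 _] := dy z.1.
  by rewrite /T /= !lorentzDl !lorentzZl y1 t1 N1 mulrN1 mulr0 add0r addr0.
have E2 z : euclid (T z).2 y.2 = z.2.1.2.
  have [_ t2] := dy z.1.
  by rewrite /T /= !euclidDl !euclidZl y2 t2 N2 mulr1 mulr0 add0r addr0.
have yw (w : 'L[R]_(k, m)) b c : tangent y w -> inner (b *: y.1, c *: y.2) w = 0.
  move=> [w1 w2]; rewrite /inner /= lorentzZl euclidZl lorentzC euclidC w1 w2.
  by rewrite !mulr0 addr0.
have E3 z : inner (T z) N = z.2.2.
  by rewrite /T !innerDl innerZl NN dN yw // mulr1 !add0r.
have E4 z u : inner (T z) (d u) = inner (d z.1) (d u).
  by rewrite /T !innerDl innerZl yw // (innerC N) dN mulr0 !addr0.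
(* [E1] to [E3] recover the three scalars, and [E4] taken at [z.1] gives
   [inner (d z.1) (d z.1) = 0]. *)
have Tinj z : T z = 0 -> z = 0.
  move=> Tz; move: (E1 z) (E2 z) (E3 z) (E4 z z.1).
  rewrite Tz /= lorentz0l euclid0l !inner0l.
  case: z {Tz} => u [[b c] e] /= /esym/eqP; rewrite oppr_eq0 => /eqP -> <- <- duu.
  have -> // : u = 0.
  by apply/eqP/negPn/negP => /d0; rewrite -duu ltxx.
have Tsurj : exists z, N' = T z.
  have k0 : lker (linfun TL) == 0%VS.
    by apply/lker0P => z z'; rewrite !lfunE /= => E;
       apply/eqP; rewrite -subr_eq0; apply/eqP/Tinj;
       rewrite -[T _]/(TL _) linearB; apply/eqP; rewrite subr_eq0; apply/eqP.
  have := limg_dim_eq (f := linfun TL) (U := fullv).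
  rewrite (eqP k0) capv0 => /(_ erefl); rewrite !dimvf /= => dimT.
  have im : limg (linfun TL) = fullv.
    apply/eqP; rewrite eqEdim subvf dimT dimvf /=.
    (* The ambient space has dimension [k + m + 2] and the source of [T] has dimension [n + 3]; they
       agree by [hn]. *)
    rewrite -[leqLHS]/(1 * k.+1 + 1 * m.+1)%N -[leqRHS]/(1 * n + 3)%N.
    by rewrite !mul1n addSn addnS hn addn3.
  have : N' \in limg (linfun TL) by rewrite im memvf.
  by move=> /memv_imgP[z _ ->]; exists z; rewrite lfunE.
have [z zE] := Tsurj.
have duu : inner (d z.1) (d z.1) = 0 by rewrite -E4 -zE innerC dN'.
have u0 : z.1 = 0 by apply/eqP/negPn/negP => /d0; rewrite duu ltxx.
have b0 : z.2.1.1 = 0 by apply/eqP; rewrite -oppr_eq0 -E1 -zE N1'.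
have c0 : z.2.1.2 = 0 by rewrite -E2 -zE N2'.
by rewrite zE E3 /T u0 b0 c0 linear0 !scale0r add0r -[X in X + _]/(0 : 'L[R]_(k, m)) add0r.
Qed.

(** * The axis of an umbilical hypersurface *)

Lemma class_CS (R : realType) (V W : normedModType R) (j : nat)
    (U U' : set V) (h : V -> W) : U' `<=` U -> class_C j U h -> class_C j U' h.
Proof.
move=> UU'; elim: j h => [|j IH] h /= => [hc x /UU'|[h1 h2]]; first exact: hc.
by split=> [x /UU'|v]; [exact: h1 | exact: IH].
Qed.

Lemma smooth_onS (R : realType) (n : nat) (M : topologicalType)
    (X : manifold R n M) (W : normedModType R) (D D' : set M) (h : M -> W) :
  D' `<=` D -> smooth_on X D h -> smooth_on X D' h.
Proof.
move=> DD' hD c cX j; apply: class_CS (hD c cX j).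
by move=> _ [p [D'p cp] <-]; exists p => //; split=> //; apply: DD'.
Qed.

Lemma chart_invK (R : realType) (n : nat) (M : topologicalType)
    (c : chart R n M) p : chart_dom c p -> chart_inv c (chart_map c p) = p.
Proof. by move=> cp; apply: chart_mapK; rewrite inE. Qed.

(** Inside the open chart image, this set is the preimage of [D] under the continuous
    [chart_inv c]. *)
Lemma open_chart_image (R : realType) (n : nat) (M : topologicalType)
    (c : chart R n M) (D : set M) : open D ->
  open (chart_map c @` (D `&` chart_dom c)).
Proof.
move=> Do; rewrite openE => _ [p [Dp cp] <-].
have ip : (chart_map c @` chart_dom c) (chart_map c p) by exists p.
have H1 : nbhs (chart_map c p) (chart_map c @` chart_dom c).
  by apply: open_nbhs_nbhs; split=> //; exact: chart_img_open.
have H2 : nbhs (chart_map c p) (chart_inv c @^-1` D).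
  apply: (chart_inv_cont ip); rewrite chart_invK //.
  exact: open_nbhs_nbhs.
apply: filterS (filterI H1 H2) => _ [[q cq <-]]; rewrite /preimage /= chart_invK //.
by move=> Dq; exists q.
Qed.

Section Hypersurface.
Context (R : realType) (n : nat) (M : topologicalType) (X : manifold R n M)
  (g : riemannian_metric X) (k m : nat) (f : M -> 'L[R]_(k, m)).
Context (fI : isometric_immersion g f).

Lemma immersion_smooth c (D : set M) : atlas X c ->
  twice_differentiable (chart_map c @` (D `&` chart_dom c)) (f \o chart_inv c).
Proof.
move=> cX; apply: smooth_twice_differentiable.
have [fs _ _] := fI.
exact: (smooth_onS (@subsetT _ D) fs cX).
Qed.

Lemma pushforwardE c p u : atlas X c -> chart_dom c p ->
  pushforward c f p u = 'D_u (f \o chart_inv c) (chart_map c p).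
Proof.
move=> cX cp; rewrite deriveE //.
have [] := immersion_smooth (D := [set: M]) cX (y := chart_map c p).
  by exists p.
by [].
Qed.

Lemma immersion_pos c p u : atlas X c -> chart_dom c p -> u != 0 ->
  0 < inner (pushforward c f p u) (pushforward c f p u).
Proof. by move=> cX cp u0; have [_ _ ->] := fI; rewrite ?gram_pos. Qed.

Lemma umbilic_immersion_chart c (D : set M) (N : M -> 'L[R]_(k, m))
    (lam : M -> R) : atlas X c -> unit_normal X f D N -> smooth_on X D lam ->
  (forall p, D p -> chart_dom c p -> is_shape_operator f N c p (lam p)%:M) ->
  umbilic_immersion (chart_map c @` (D `&` chart_dom c)) (f \o chart_inv c)
    (N \o chart_inv c) (lam \o chart_inv c).
Proof.
move=> cX [Ns N1 No] ls sh; split.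
- exact: immersion_smooth.
- exact/smooth_twice_differentiable/Ns.
- exact/smooth_twice_differentiable/ls.
- by move=> _ [p [Dp cp] <-]; rewrite /= chart_invK //; have [_ fp _] := fI.
- by move=> _ [p [Dp cp] <-]; rewrite /= chart_invK //; have [] := N1 p Dp.
- move=> _ u [p [Dp cp] <-]; rewrite -pushforwardE //= chart_invK //.
  exact: No.
- move=> _ u [p [Dp cp] <-] u0; rewrite -pushforwardE //.
  exact: immersion_pos.
- move=> y u Uy; have [N1y _] := smooth_twice_differentiable (Ns c cX) Uy.
  case: Uy N1y => p [Dp cp] <- {y} N1y.
  have := sh p Dp cp u; rewrite mul_mx_scalar /pushforward /=.
  rewrite chart_invK // (deriveE u N1y) => <-.
  by rewrite -/(pushforward c f p u) -/(pushforward c f p _) -pushforwardE // /pushforward linearZ.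
Qed.

Lemma near_chart_inv (c : chart R n M) p (P : set M) : chart_dom c p ->
  (\forall q \near p, P q) ->
  \forall y \near chart_map c p, P (chart_inv c y).
Proof.
move=> cp Pp; have ip : (chart_map c @` chart_dom c) (chart_map c p) by exists p.
by apply: (chart_inv_cont ip); rewrite chart_invK.
Qed.

Lemma tangent_pushforward c p u : atlas X c -> chart_dom c p ->
  tangent (f p) (pushforward c f p u).
Proof.
move=> cX cp; rewrite pushforwardE // -[p in f p](chart_invK cp).
apply: (tangent_derive (F := f \o chart_inv c)).
  by have [] := immersion_smooth (D := [set: M]) cX (y := chart_map c p); [exists p|].
by apply: (@filterE _ (nbhs (chart_map c p))) => y; have [_ + _] := fI; apply.
Qed.

Lemma immersion_null p : inner (f p) (f p) = 0.
Proof. by have [_ /(_ p)[[E1 _] E2] _] := fI; rewrite /inner E1 E2 addNr. Qed.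

Lemma inner_tangent p w : tangent (f p) w -> inner w (f p) = 0.
Proof. by move=> [E1 E2]; rewrite /inner E1 E2 addr0. Qed.

(** No normal field or curvature is mentioned, so axes built from different local normals can be
    compared. *)
Definition orthogonal_axis (V : 'L[R]_(k, m)) (p : M) :=
  [/\ inner V V = 1, inner (f p) V = 0 &
     forall c u, atlas X c -> chart_dom c p -> inner (pushforward c f p u) V = 0].

Lemma orthogonal_axisN V p : orthogonal_axis V p -> orthogonal_axis (- V) p.
Proof.
move=> [E1 E2 E3]; split.
- by rewrite innerNl innerNr opprK.
- by rewrite innerNr E2 oppr0.
- by move=> c u cX cp; rewrite innerNr E3 ?oppr0.
Qed.

Lemma orthogonal_axis_normal V p :
  let N := V - euclid V.2 (f p).2 *: f p in
  orthogonal_axis V p ->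
  [/\ tangent (f p) N, inner N N = 1 &
     forall c u, atlas X c -> chart_dom c p -> inner (pushforward c f p u) N = 0].
Proof.
move=> N [VV fV dV]; have [_ /(_ p)[[f1 _] f2] _] := fI.
have E : lorentz V.1 (f p).1 = - euclid V.2 (f p).2.
  by apply/eqP; rewrite -addr_eq0 -[_ + _]/(inner V (f p)) innerC fV.
split.
- split; rewrite /N /=.
    by rewrite lorentzDl lorentzNl lorentzZl f1 E mulrN1 opprK addNr.
  by rewrite euclidDl euclidNl euclidZl f2 mulr1 addrN.
- rewrite /N innerDl !innerDr !innerNl !innerNr !innerZl !innerZr.
  by rewrite immersion_null (innerC V (f p)) fV VV; ring.
- move=> c u cX cp; rewrite /N innerDr innerNr innerZr dV //.
  by rewrite (inner_tangent (tangent_pushforward u cX cp)); ring.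
Qed.

(** Uniqueness of the normal makes the constant vector [C] a multiple of [f q] at every nearby [q],
    and gives [e ^+ 2 = 1]. Differentiating this relation in a tangent direction shows that the
    multiple is zero at [p]. *)
Lemma orthogonal_axis_unique (hn : (k + m = n.+1)%N) (n0 : (0 < n)%N) V V' (p : M) :
  (\forall q \near p, orthogonal_axis V q) ->
  (\forall q \near p, orthogonal_axis V' q) -> V' = V \/ V' = - V.
Proof.
move=> nV nV'; have [c cX cp] := atlas_cover X p.
have cnear : \forall q \near p, chart_dom c q.
  by apply: open_nbhs_nbhs; split=> //; exact: chart_dom_open.
pose e := inner V' V; pose C := V' - e *: V.
(* Written as [euclid C.2 (f q).2], the coefficient is a differentiable function of [q]. *)
have key : \forall q \near p, C = euclid C.2 (f q).2 *: f q /\ e ^+ 2 = 1.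
  apply: filterS (filterI cnear (filterI nV nV')) => q [cq [aV aV']].
  have [NT NN dN] := orthogonal_axis_normal aV.
  have [NT' NN' dN'] := orthogonal_axis_normal aV'.
  have [_ fV _] := aV; have [_ fV' _] := aV'.
  have [_ /(_ q) fq _] := fI.
  have := unit_normal_unique hn (d := 'd (f \o chart_inv c) (chart_map c q)) fq
     (fun u => tangent_pushforward u cX cq) (fun u => immersion_pos cX cq)
     NT NN (fun u => dN c u cX cq) NT' (fun u => dN' c u cX cq).
  set N := V - _ in NN *; set N' := V' - _ in NN' *.
  have -> : inner N' N = e.
    rewrite /N /N' innerDl !innerDr !innerNl !innerNr !innerZl !innerZr.
    by rewrite immersion_null (innerC V' (f q)) fV' fV /e; ring.
  move=> NE; split; last by move: NN'; rewrite NE innerZl innerZr NN mulr1 => <-.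
  have CE : C = (euclid V'.2 (f q).2 - e * euclid V.2 (f q).2) *: f q.
    move/eqP: NE; rewrite /N' subr_eq => /eqP VE.
    rewrite /C {1}VE /N scalerBr scalerA scalerBl.
    by rewrite addrAC (addrAC (e *: V)) subrr sub0r addrC.
  rewrite {1}CE; congr (_ *: _).
  by rewrite /C /= euclidDl euclidNl euclidZl.
have [CE e1] := nbhs_singleton key.
suff C0 : C = 0.
  move/eqP: C0; rewrite subr_eq0 => /eqP ->.
  move/eqP: e1; rewrite sqrf_eq1 => /orP[]/eqP ->; rewrite ?scale1r ?scaleN1r.
    by left.
  by right.
pose x := chart_map c p; pose F := f \o chart_inv c.
pose u : 'rV[R]_n := const_mx 1.
have u0 : u != 0.
  apply/eqP => /rowP/(_ (Ordinal n0)); rewrite !mxE => /eqP.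
  by rewrite oner_eq0.
have FD : is_derive x u F (pushforward c f p u).
  apply: DeriveDef; last by rewrite pushforwardE.
  apply: diff_derivable.
  by have [] := immersion_smooth (D := [set: M]) cX (y := x); [exists p|].
set w := pushforward c f p u in FD.
have FwD : is_derive x u (fun z => inner (F z) w) (inner w w).
  have := is_derive_inner FD (is_derive_cst w x u).
  by rewrite [X in _ + X]innerC inner0l addr0.
have kD : is_derive x u (fun z => euclid C.2 (F z).2) (euclid C.2 w.2).
  have := is_derive_euclid (is_derive_cst C.2 x u) (is_derive_snd FD).
  by rewrite euclid0l add0r.
(* At [x] the derivative of the coefficient is multiplied by [inner (f p) w = 0], so only the
   coefficient times [inner w w] remains. *)
have := is_deriveM kD FwD; move/(is_derive_locally_constant (c := inner C w)).
rewrite /F /= chart_invK // (innerC (f p)).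
rewrite (inner_tangent (tangent_pushforward u cX cp)) scale0r addr0 => H.
have /H/eqP : \forall y \near x, euclid C.2 (f (chart_inv c y)).2 *
    inner (f (chart_inv c y)) w = inner C w.
  apply: filterS (near_chart_inv cp key) => y [E _].
  by rewrite {2}E innerZl.
rewrite scaler_eq0 (gt_eqF (immersion_pos cX cp u0)) orbF => /eqP k0.
by rewrite CE k0 scale0r.
Qed.

(** Each pairing of [N + lam f] with a fixed vector has zero derivative on a chart ball, so the
    vector is constant there. The formula for [V] is kept in the conclusion because [lam] is later
    recovered from it. *)
Lemma umbilic_axis (n1 : (1 < n)%N) (D : set M)
    (N : M -> 'L[R]_(k, m))
    (lam : M -> R) (p : M) : open_nbhs p D -> unit_normal X f D N ->
  smooth_on X D lam ->
  (forall c q, atlas X c -> D q -> chart_dom c q ->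
    is_shape_operator f N c q (lam q)%:M) ->
  exists V, \forall q \near p, orthogonal_axis V q /\ V = N q + lam q *: f q.
Proof.
move=> pD nN sl sh; have [Do Dp] := pD.
have [c cX cp] := atlas_cover X p.
pose U := chart_map c @` (D `&` chart_dom c); pose x := chart_map c p.
have Uo : open U by exact: open_chart_image.
have Ux : U x by exists p.
have H := umbilic_immersion_chart cX nN sl (fun q Dq cq => sh c q cX Dq cq).
have /nbhs_ballP[r /= r0 rU] : nbhs x U by apply: open_nbhs_nbhs.
(* If coordinate [i1] of [u] vanishes, the basis vector at [i1] is no multiple of [u]; otherwise a
   multiple of [u] equal to the basis vector at [i0] would have factor 0. *)
have Vdim (u : 'rV[R]_n) : exists v, forall a, v != a *: u.
  pose i0 := Ordinal (ltnW n1); pose i1 := Ordinal n1.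
  have [u0|u0] := eqVneq (u 0 i1) 0.
    exists (delta_mx 0 i1) => a; apply/eqP => /rowP/(_ i1)/eqP.
    by rewrite !mxE !eqxx u0 mulr0 oner_eq0.
  exists (delta_mx 0 i0) => a; apply/eqP => E.
  have := congr1 (fun v : 'rV[R]_n => v 0 i1) E; rewrite !mxE /= => /esym/eqP.
  rewrite mulf_eq0 (negbTE u0) orbF => /eqP a0.
  have := congr1 (fun v : 'rV[R]_n => v 0 i0) E.
  by rewrite !mxE /= a0 mul0r => /eqP; rewrite oner_eq0.
exists (N p + lam p *: f p).
have Dnear : \forall q \near p, D q by exact: open_nbhs_nbhs.
have cnear : \forall q \near p, chart_dom c q.
  by apply: open_nbhs_nbhs; split=> //; exact: chart_dom_open.
have bnear : \forall q \near p, ball x r (chart_map c q).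
  by apply: (chart_map_cont cp); exact: nbhsx_ballx.
apply: filterS (filterI Dnear (filterI cnear bnear)) => q [Dq [cq bq]].
have VE : N p + lam p *: f p = N q + lam q *: f q.
  apply/esym/eqP; rewrite -subr_eq0; apply/eqP/inner_nondegenerate => e.
  rewrite innerDl innerNl; apply/eqP; rewrite subr_eq0; apply/eqP.
  have := constant_on_ball (x := x) (r := r)
    (fun y v yr => is_derive_umbilic_axis Uo H Vdim v e (rU y yr)) bq.
  by rewrite /= !chart_invK // !innerDl !innerZl.
split=> //; rewrite VE {VE}.
have [_ /(_ q Dq)[NT NN] dN] := nN.
have Nf := inner_tangent NT.
split.
- rewrite innerDl !innerDr !innerZl !innerZr (innerC (f q) (N q)) Nf NN immersion_null; ring.
- by rewrite innerDr innerZr (innerC (f q) (N q)) Nf immersion_null mulr0 addr0.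
- move=> c' u c'X c'q; rewrite innerDr innerZr dN //.
  by rewrite (inner_tangent (tangent_pushforward u c'X c'q)) mulr0 addr0.
Qed.

End Hypersurface.

(** * Reflections *)

Definition reflection (R : realType) (k m : nat) (V x : 'L[R]_(k, m)) :=
  x - (2 * inner x V) *: V.

Lemma reflection_linear (R : realType) (k m : nat) (V : 'L[R]_(k, m)) :
  linear (reflection V).
Proof.
move=> a x y; rewrite /reflection innerDl innerZl mulrDr scalerDl opprD.
by rewrite scalerBr scalerA addrACA mulrCA.
Qed.

HB.instance Definition _ (R : realType) (k m : nat) (V : 'L[R]_(k, m)) :=
  GRing.isLinear.Build R 'L[R]_(k, m) 'L[R]_(k, m) _ (reflection V)
    (reflection_linear V).

Lemma reflection_isometry (R : realType) (k m : nat) (V : 'L[R]_(k, m)) :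
  inner V V = 1 -> linear_isometry (reflection V).
Proof.
move=> VV x y; rewrite /= /reflection innerDl !innerDr !innerNl !innerNr.
rewrite !innerZl !innerZr VV (innerC V y); ring.
Qed.

(** The vector [(x.1, 0)] of the Lorentz factor is sent to one with second component
    [- (2 * lorentz x.1 V.1) *: V.2], which is nonzero. *)
Lemma reflection_not_preserving (R : realType) (k m : nat)
    (V x : 'L[R]_(k, m)) :
  lorentz x.1 V.1 != 0 -> V.2 != 0 -> ~ preserves_factors (reflection V).
Proof.
move=> x1 V2 [E _].
have : (reflection V @` [set x | x.2 = 0]) (reflection V (x.1, 0)).
  by exists (x.1, 0).
rewrite E /= /reflection /inner /= euclid0l addr0 sub0r => /eqP.
by rewrite oppr_eq0 scaler_eq0 (negbTE V2) orbF mulf_eq0 (negbTE x1) pnatr_eq0.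
Qed.

(** * The global axis and the deformation *)

Section Umbilical.
Context (R : realType) (n : nat) (M : topologicalType) (X : manifold R n M)
  (g : riemannian_metric X) (k m : nat) (f : M -> 'L[R]_(k, m)).
Context (hn : (k + m = n.+1)%N) (n1 : (1 < n)%N)
  (fI : isometric_immersion g f) (fU : umbilical X f).

(* The axis is only locally defined up to sign, so connectedness is applied to
   the set of points near which a fixed vector is an axis. *)
Lemma umbilical_axis (p0 : M) : exists V, forall p : M,
  \forall q \near p, orthogonal_axis X f V q.
Proof.
have loc (p : M) : exists V, \forall q \near p, orthogonal_axis X f V q.
  have [D [N [lam [pD nN sl sh]]]] := fU p.
  have [V VE] := umbilic_axis fI n1 pD nN sl (fun c q cX => sh c q cX).
  by exists V; apply: filterS VE => q [].
have [V V0] := loc p0; exists V.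
pose A := [set p : M | \forall q \near p, orthogonal_axis X f V q].
suff AT : A = [set: M] by move=> p; have : [set: M] p by []; rewrite -AT.
have Ao : open A by rewrite openE => p; apply: near_join.
apply: (manifold_connected X); first by exists p0.
  by exists A; rewrite ?setTI.
(* For closedness, let [V'] be an axis near a point [p] outside [A]. A nearby point of [A] would
   give [V = V'] or [V = - V'], and [V] would be an axis near [p] too. *)
exists A; rewrite ?setTI //; rewrite -openC openE => p nAp.
have [V' V'p] := loc p.
rewrite /interior; apply: filterS (near_join V'p) => q V'q Aq; apply: nAp.
have [VV'|VV'] := orthogonal_axis_unique fI hn (ltnW n1) V'q Aq.
  by rewrite /A /= VV'.
by rewrite /A /= VV'; apply: filterS V'p => r; apply: orthogonal_axisN.
Qed.

(** Pairing the first components of [f] and [N + lam f] gives [- lam], because [N] is tangent and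
    [lorentz (f p).1 (f p).1 = -1]. If [V] paired to zero everywhere, [lam] would vanish and the
    shape operator with it. *)
Lemma axis_not_in_sphere_factor V : ~ totally_geodesic X f ->
  (forall p : M, \forall q \near p, orthogonal_axis X f V q) ->
  exists p, lorentz (f p).1 V.1 != 0.
Proof.
move=> ntg aV; apply: contrapT => /forallNP fV; apply: ntg => p0.
have [D [N [lam [pD nN sl sh]]]] := fU p0; have [Do Dp] := pD.
exists D, N; split=> // c p cX Dp' cp.
have := sh c p cX Dp' cp; suff -> : lam p = 0 by rewrite raddf0.
(* The local axis is rebuilt at [p] instead of [p0], since its formula is only known near the base
   point. *)
have [V' V'p] := umbilic_axis fI n1 (conj Do Dp') nN sl (fun c q cX => sh c q cX).
have [_ V'E] := nbhs_singleton V'p.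
have V'1 : lorentz (f p).1 V'.1 = 0.
  have fVp : lorentz (f p).1 V.1 = 0 by apply/eqP/negPn/negP/fV.
  have aV' : \forall q \near p, orthogonal_axis X f V' q.
    by apply: filterS V'p => q [].
  have [-> //|->] := orthogonal_axis_unique fI hn (ltnW n1) (aV p) aV'.
  by rewrite lorentzC lorentzNl lorentzC fVp oppr0.
have [_ /(_ p Dp')[[N1 _] _] _] := nN; have [_ /(_ p)[[f1 _] _] _] := fI.
move: V'1; rewrite V'E /= lorentzDr lorentzZr lorentzC N1 f1 add0r mulrN1.
by move/eqP; rewrite oppr_eq0 => /eqP.
Qed.

End Umbilical.

Theorem proposition17 (R : realType) (n k : nat) (hk : (2 <= k <= n - 1)%N)
    (M : topologicalType) (X : manifold R n M) (g : riemannian_metric X)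
    (f : M -> 'L[R]_(k, n - k + 1)) :
  isometric_immersion g f -> umbilical X f -> ~ totally_geodesic X f ->
  exists f' : M -> 'L[R]_(k, n - k + 1),
    weakly_congruent_deformation g f f' /\ umbilical X f'.
Proof.
move=> fI fU ntg; have /andP[k2 kn] := hk.
have le_kn : (k <= n)%N by apply: leq_trans kn (leq_subr _ _).
have hn : (k + (n - k + 1) = n.+1)%N by rewrite addnA subnKC // addn1.
have n1 : (1 < n)%N by apply: leq_trans k2 le_kn.
(* An empty [M] would be totally geodesic vacuously. *)
have [p0 _] : exists p : M, True.
  by apply: contrapT => noM; apply: ntg => p; case: noM; exists p.
have [V aV] := umbilical_axis hn n1 fI fU p0.
have [p fV1] := axis_not_in_sphere_factor hn n1 fI fU ntg aV.
have [VV fV _] := nbhs_singleton (aV p).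
(* Otherwise orthogonality of [f p] and [V] would reduce to [lorentz (f p).1 V.1 = 0]. *)
have V2 : V.2 != 0.
  apply/eqP => V2; move: fV; rewrite /inner V2 euclidC euclid0l addr0 => E.
  by rewrite E eqxx in fV1.
exists f; split=> //; split=> //; exists (reflection V).
split; [exact: reflection_isometry | exact: reflection_not_preserving fV1 V2 |].
apply/funext => q; have [_ fVq _] := nbhs_singleton (aV q).
by rewrite /= /reflection fVq mulr0 scale0r subr0.
Qed.
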